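(* Let $(Y,d)$ be a compact metric space, let $\Delta=\{(x_n,y_n)\in\mathbb{R}\times Y : n\ge 0\}$ be a countable system of data, and let $a,b,m,M$, $(l_n)_{n\ge1}$, $(L_n)_{n\ge1}$, $(W_n)_{n\ge 1}$ and $(f_n)_{n\ge1}$ be as described in the context. Suppose that there exist $L>0$ and a non-decreasing function $\varphi:[0,\infty)\to[0,\infty)$, with $\frac{\varphi(t)}{t}<1$ for all $t>0$ and $t\mapsto\frac{\varphi(t)}{t}$ non-increasing on $(0,\infty)$, such that $$d(W_n(x,y),W_n(x',y'))\le L|x-x'|+\varphi(d(y,y'))$$ for all $(x,y),(x',y')\in[a,b]\times Y$ and all $n\ge1$. Let $d_\theta((x,y),(x',y'))=|x-x'|+\theta\, d(y,y')$ on $[a,b]\times Y$, where $\theta=\dfrac{1-\sup_{n\ge1}L_n}{2(L+1)}$. Then there exists an interpolation function $f_*$ corresponding to $\Delta$ such that its graph $\{(x,f_*(x)) : x\in[a,b]\}$ is the attractor of the countable iterated function system $\mathcal{S}=(([a,b]\times Y,d_\theta),(f_n)_{n\ge1})$.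
   Context: Countable system of data: given a compact metric space $(Y,d)$, a family $\Delta=\{(x_n,y_n)\in\mathbb{R}\times Y: n\ge0\}$ such that $(x_n)_{n\ge0}$ is strictly increasing and bounded and $(y_n)_{n\ge0}$ is convergent in $Y$. Notation: $a=x_0$, $b=\lim_{n\to\infty}x_n$, $m=y_0$, $M=\lim_{n\to\infty}y_n$. An interpolation function corresponding to $\Delta$ is a continuous function $f:[a,b]\to Y$ with $f(x_n)=y_n$ for each $n\ge0$. Associated maps (fixed as data): for each $n\ge1$, $l_n:[a,b]\to[x_{n-1},x_n]$ is a homeomorphism for which there is $L_n\in[0,1)$ with $|l_n(x)-l_n(x')|\le L_n|x-x'|$ for all $x,x'\in[a,b]$, with $l_n(a)=x_{n-1}$, $l_n(b)=x_n$, and $\sup_{n\ge1}L_n<1$ (the constants $L_n$ are fixed). For each $n\ge1$, $W_n:[a,b]\times Y\to Y$ is a continuous function with $W_n(a,m)=y_{n-1}$, $W_n(b,M)=y_n$, and $\lim_{n\to\infty}\mathrm{diam}(\mathrm{Im}\,W_n)=0$. For $n\ge1$, $f_n:[a,b]\times Y\to[a,b]\times Y$ is defined by $f_n(x,y)=(l_n(x),W_n(x,y))$. Countable iterated function system (CIFS): a pair $\mathcal{S}=((X,\rho),(f_n)_{n\ge1})$ with $(X,\rho)$ a compact metric space and $f_n:X\to X$ continuous for every $n\ge1$. Let $\mathcal{P}_{cp}(X)$ be the set of non-empty compact subsets of $X$ with the Hausdorff metric $h$. The fractal operator is $F_{\mathcal{S}}:\mathcal{P}_{cp}(X)\to\mathcal{P}_{cp}(X)$,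 $F_{\mathcal{S}}(K)=\overline{\bigcup_{n\ge1}f_n(K)}$. An operator $g:Z\to Z$ on a metric space is a Picard operator if it has a unique fixed point $z_*$ and $\lim_{k\to\infty}g^{[k]}(z)=z_*$ for every $z\in Z$, where $g^{[k]}$ is the $k$-fold composition. If $F_{\mathcal{S}}$ is a Picard operator, $\mathcal{S}$ is said to have attractor, and the fixed point of $F_{\mathcal{S}}$ is called the attractor of $\mathcal{S}$. (The claim that the graph is the attractor includes that $\mathcal{S}$ has attractor.) *)

(* Defs.v *)
From HB Require Import structures.
From mathcomp Require Import all_boot all_order all_algebra.
From mathcomp Require Import all_classical all_reals all_analysis.
From mathcomp Require Import ring lra.

Set Implicit Arguments.
Unset Strict Implicit.
Unset Printing Implicit Defensive.

Import Order.TTheory GRing.Theory Num.Theory.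
Import numFieldNormedType.Exports.
Import metricType_numDomainType.

Local Open Scope classical_set_scope.
Local Open Scope ring_scope.

(* The library endows a subset [A : set R], seen as a type, with the induced
   topology and balls; this adds the distance [|s - t|] that they come from. *)
Section SubsetMetric.
Context (R : realType) (A : set R).

Definition sub_mdist (s t : A) : R := `|set_val s - set_val t|.

Lemma sub_mdist_ge0 s t : 0 <= sub_mdist s t.
Proof. exact: normr_ge0. Qed.

Lemma sub_mdist_positivity s t : sub_mdist s t = 0 -> s = t.
Proof. by move=> /normr0_eq0/eqP; rewrite subr_eq0 => /eqP /val_inj. Qed.

Lemma sub_ballEmdist (s : A) (r : R) : ball s r = [set t | sub_mdist s t < r].
Proof. by []. Qed.

HB.instance Definition _ := @PseudoMetric_isMetric.Build R (A : Type)
  sub_mdist sub_mdist_ge0 sub_mdist_positivity sub_ballEmdist.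

End SubsetMetric.

Notation seg a b := (set_type `[a, b]%classic).

Lemma seg_compact (R : realType) (a b : R) : compact [set: seg a b].
Proof.
have [le_ab|lt_ba] := leP a b; last first.
  have -> : [set: seg a b] = set0; last exact: compact0.
  apply/seteqP; split=> // -[s sab] _.
  move/set_mem: (sab); rewrite /= in_itv/= => /andP[as_ sb].
  by move: (le_trans as_ sb); rewrite leNgt lt_ba.
have Ha : a \in `[a, b]%classic by rewrite inE/= in_itv/= lexx le_ab.
pose e : seg a b := exist _ a Ha.
pose g (t : R) : seg a b := insubd e t.
have gE t : t \in `[a, b]%classic -> set_val (g t) = t.
  by move=> tab; rewrite /g set_valE; exact: insubdK.
have -> : [set: seg a b] = g @` `[a, b]%classic.
  apply/seteqP; split=> // s _; exists (set_val s).
    by apply: set_mem; exact: (valP s).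
  by apply: val_inj; rewrite -set_valE gE//; exact: (valP s).
apply: continuous_compact; last exact: segment_compact.
apply/subspace_sigL_continuousP => s U /nbhs_mdistP[r /= r0 rU].
rewrite nbhs_simpl/=; apply/(@nbhs_mdistP R (seg a b)); exists r => // t /= st.
apply: rU => /=; move: st; rewrite /mdist/= /sub_mdist/= /sigL/=.
by rewrite !gE//; apply: valP.
Qed.

(* [U * V] with the metric d_theta; it is an alias because the library's metric
   structure on [U * V] has the maximum of the two distances. *)
Definition wprod (R : realType) (theta : {posnum R}) (U V : metricType R) : Type :=
  (U * V)%type.

Section WeightedProduct.
Context (R : realType) (theta : {posnum R}) (U V : metricType R).
Local Notation X := (wprod theta U V).

HB.instance Definition _ := Choice.copy X (U * V)%type.

Definition wdist (p q : X) : R := mdist p.1 q.1 + theta%:num * mdist p.2 q.2.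

Lemma wdistxx p : wdist p p = 0.
Proof. by rewrite /wdist !mdistxx mulr0 addr0. Qed.

Lemma wdist_positivity p q : wdist p q = 0 -> p = q.
Proof.
move=> /eqP; rewrite /wdist paddr_eq0 ?mulr_ge0 ?mdist_ge0//.
case/andP=> /eqP/mdist_positivity e1.
rewrite mulf_eq0 gt_eqF//= => /eqP/mdist_positivity e2.
by case: p q e1 e2 => [? ?] [? ?]/= -> ->.
Qed.

Lemma wdist_sym p q : wdist p q = wdist q p.
Proof. by rewrite /wdist metric_sym (metric_sym p.2). Qed.

Lemma wdist_triangle q p r : wdist p r <= wdist p q + wdist q r.
Proof.
rewrite /wdist addrACA -mulrDr lerD ?metric_triangle//.
by rewrite ler_pM2l// metric_triangle.
Qed.

HB.instance Definition _ := @isMetric.Build R X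
  wdist wdistxx wdist_positivity wdist_sym wdist_triangle.

Lemma wprod_mdistE (p q : X) :
  mdist p q = mdist p.1 q.1 + theta%:num * mdist p.2 q.2.
Proof. by []. Qed.

Lemma to_wprod_continuous : continuous (idfun : U * V -> X).
Proof.
move=> p A /nbhs_mdistP[r /= r0 rA].
exists (ball p.1 (r / 2), ball p.2 (r / 2 / theta%:num)).
  by split; apply: nbhsx_ballx; rewrite ?divr_gt0.
case=> u v [/=]; rewrite !ballEmdist/= => h1 h2; apply: rA => /=.
rewrite wprod_mdistE [r]splitr; apply: ltrD => //.
by rewrite mulrC -ltr_pdivlMr.
Qed.

Lemma of_wprod_continuous : continuous (idfun : X -> U * V).
Proof.
move=> p A [[B C]/= [/nbhs_mdistP[r /= r0 rB] /nbhs_mdistP[s /= s0 sC]] BCA].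
rewrite nbhs_simpl/=; apply/(@nbhs_mdistP R X); exists (Num.min r (theta%:num * s)) => /=.
  by rewrite lt_min r0 mulr_gt0.
move=> q /=; rewrite wprod_mdistE lt_min => /andP[h1 h2]; apply: BCA; split => /=.
  apply: rB => /=; apply: le_lt_trans h1.
  by rewrite lerDl mulr_ge0 ?mdist_ge0.
apply: sC => /=; rewrite -(@ltr_pM2l _ theta%:num)//; apply: le_lt_trans h2.
by rewrite lerDr mdist_ge0.
Qed.

Lemma wprod_compact :
  compact [set: U] -> compact [set: V] -> compact [set: X].
Proof.
move=> cU cV; have := compact_setX cU cV; rewrite setXTT => cUV.
have := @continuous_compact (U * V)%type X idfun _ _ cUV.
rewrite image_id; apply.
by apply: continuous_subspaceT => ?; apply: to_wprod_continuous.
Qed.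

End WeightedProduct.

Section Hyperspace.
Context (R : realType) (X : metricType R).

Record pcp : Type := Pcp {
  pcp_set :> set X;
  pcp_nonempty : pcp_set !=set0;
  pcp_compact : compact pcp_set }.

Lemma pcp_inj (A B : pcp) : pcp_set A = pcp_set B -> A = B.
Proof.
case: A B => [A A0 cA] [B B0 cB] /= AB; rewrite -AB in B0 cB *.
by rewrite (Prop_irrelevance A0 B0) (Prop_irrelevance cA cB).
Qed.

(* [inf] and [sup] are total, with value 0 on empty or unbounded sets; the
   distance below is only meant for non-empty compact sets. *)
Definition dist_to (x : X) (B : set X) : R := inf [set mdist x y | y in B].

Definition excess (A B : set X) : R := sup [set dist_to x B | x in A].

Definition hausdorff_dist (A B : set X) : R := Num.max (excess A B) (excess B A).

Lemma mdist_continuous (p : X) : continuous (mdist p : X -> R).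
Proof.
move=> x A; rewrite nbhs_simpl/= => /nbhs_ballP[r /= r0 rA].
apply/(@nbhs_mdistP R X); exists r => // y /= xy; apply: rA => /=.
rewrite /ball/=; apply: le_lt_trans xy; rewrite ler_norml; apply/andP; split.
- have := metric_triangle p x y; lra.
- have := metric_triangle p y x; rewrite (metric_sym y x); lra.
Qed.

Lemma pcp_bounded (A : pcp) (p : X) : exists C : R, forall x, pcp_set A x -> mdist p x <= C.
Proof.
have cA : compact (mdist p @` A).
  apply: continuous_compact (@pcp_compact A).
  by apply: continuous_subspaceT; exact: mdist_continuous.
have [C [_ /(_ (C + 1))]] := compact_bounded cA.
rewrite ltrDl ltr01 => /(_ isT) h; exists (C + 1) => x Ax.
by apply: le_trans (ler_norm _) (h _ _); exists x.
Qed.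

Lemma dist_to_le (x y : X) (B : set X) : B y -> dist_to x B <= mdist x y.
Proof.
move=> By; apply: ge_inf; last by exists y.
by exists 0 => _ [z _ <-]; exact: mdist_ge0.
Qed.

Lemma dist_to_ge0 (x : X) (B : set X) : 0 <= dist_to x B.
Proof.
have [->|/set0P[y By]] := eqVneq B set0.
  by rewrite /dist_to image_set0 inf0.
apply: lb_le_inf; first by exists (mdist x y); exists y.
by move=> _ [z _ <-]; exact: mdist_ge0.
Qed.

Lemma dist_to_lt (x : X) (B : pcp) (e : R) : 0 < e ->
  exists2 y, pcp_set B y & mdist x y < dist_to x B + e.
Proof.
move=> e0; have [z Bz] := pcp_nonempty B.
have hB : has_inf [set mdist x y | y in pcp_set B].
  split; first by exists (mdist x z); exists z.
  by exists 0 => _ [w _ <-]; exact: mdist_ge0.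
by have [_ [y By <-] xy] := inf_adherent e0 hB; exists y.
Qed.

Lemma dist_to_le_excess (A B : pcp) x : pcp_set A x -> dist_to x B <= excess A B.
Proof.
move=> Ax; have [z Bz] := pcp_nonempty B.
have [C hC] := pcp_bounded A z.
apply: ub_le_sup; last by exists x.
exists C => _ [w Aw <-]; apply: le_trans (dist_to_le _ Bz) _.
by rewrite metric_sym; exact: hC.
Qed.

Lemma excess_le (A B : pcp) (r : R) :
  (forall x, pcp_set A x -> dist_to x B <= r) -> excess A B <= r.
Proof.
move=> h; have [z Az] := pcp_nonempty A.
apply: ge_sup; first by exists (dist_to z B); exists z.
by move=> _ [w Aw <-]; exact: h.
Qed.

Lemma excess_ge0 (A B : pcp) : 0 <= excess A B.
Proof.
have [z Az] := pcp_nonempty A.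
exact: le_trans (dist_to_ge0 z B) (dist_to_le_excess _ Az).
Qed.

Lemma excessxx (A : pcp) : excess A A = 0.
Proof.
apply/eqP; rewrite eq_le excess_ge0 andbT; apply: excess_le => x Ax.
by rewrite -(mdistxx x); exact: dist_to_le.
Qed.

Lemma excess_triangle (A B C : pcp) : excess A C <= excess A B + excess B C.
Proof.
apply: excess_le => x Ax; apply/ler_addgt0Pl => e e0.
have e2 : 0 < e / 2 by rewrite divr_gt0.
have [y By xy] := dist_to_lt x B e2.
have [z Cz yz] := dist_to_lt y C e2.
have := dist_to_le x Cz; have := metric_triangle x y z.
have := dist_to_le_excess B Ax; have := dist_to_le_excess C By.
lra.
Qed.

Lemma excess_sub (A B : pcp) : excess A B = 0 -> pcp_set A `<=` pcp_set B.
Proof.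
move=> h x Ax; have cB := compact_closed (@metric_hausdorff _ X) (@pcp_compact B).
apply: cB => U /nbhs_mdistP[r /= r0 rU].
have [y By xy] := dist_to_lt x B r0; exists y; split=> //; apply: rU => /=.
by apply: lt_le_trans xy _; rewrite gerDr -h; exact: dist_to_le_excess.
Qed.

Definition pcp_dist (A B : pcp) : R := hausdorff_dist A B.

Lemma pcp_distxx A : pcp_dist A A = 0.
Proof. by rewrite /pcp_dist /hausdorff_dist excessxx maxxx. Qed.

Lemma pcp_dist_positivity A B : pcp_dist A B = 0 -> A = B.
Proof.
move=> h; apply: pcp_inj; apply/seteqP; split; apply: excess_sub;
  apply/eqP; rewrite eq_le excess_ge0 andbT -h /pcp_dist /hausdorff_dist.
- by rewrite le_max lexx.
- by rewrite le_max lexx orbT.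
Qed.

Lemma pcp_dist_sym A B : pcp_dist A B = pcp_dist B A.
Proof. by rewrite /pcp_dist /hausdorff_dist maxC. Qed.

Lemma pcp_dist_triangle B A C : pcp_dist A C <= pcp_dist A B + pcp_dist B C.
Proof.
rewrite /pcp_dist {1}/hausdorff_dist ge_max; apply/andP; split.
- apply: le_trans (excess_triangle A B C) _.
  by apply: lerD; rewrite le_max lexx.
- apply: le_trans (excess_triangle C B A) _; rewrite addrC.
  by apply: lerD; rewrite le_max lexx orbT.
Qed.

HB.instance Definition _ := gen_eqMixin pcp.
HB.instance Definition _ := gen_choiceMixin pcp.
HB.instance Definition _ := @isMetric.Build R pcp
  pcp_dist pcp_distxx pcp_dist_positivity pcp_dist_sym pcp_dist_triangle.

End Hyperspace.

Definition picard_operator (R : realType) (Z : metricType R) (g : Z -> Z) : Prop :=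
  exists z : Z, [/\ g z = z, forall w, g w = w -> w = z
              & forall w, (fun k => iter k g w) @ \oo --> z].

(* Maps are indexed from 0: [cifs_map S n] is the map f_(n+1). *)
Record cifs (R : realType) : Type := Cifs {
  cifs_space :> metricType R;
  cifs_map : nat -> cifs_space -> cifs_space;
  cifs_compact : compact [set: cifs_space];
  cifs_continuous : forall n, continuous (cifs_map n) }.

Section Attractor.
Context (R : realType) (S : cifs R).

Definition fractal_set (K : set S) : set S :=
  closure (\bigcup_n (cifs_map n @` K)).

Lemma fractal_set_nonempty (K : pcp S) : fractal_set K !=set0.
Proof.
have [x Kx] := pcp_nonempty K.
by exists (cifs_map 0%N x); apply: subset_closure; exists 0%N => //; exists x.
Qed.

Lemma fractal_set_compact (K : pcp S) : compact (fractal_set K).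
Proof.
apply: subclosed_compact (@cifs_compact _ S) _ => //.
exact: closed_closure.
Qed.

Definition fractal_operator (K : pcp S) : pcp S :=
  Pcp (fractal_set_nonempty K) (@fractal_set_compact K).

Definition has_attractor : Prop := picard_operator fractal_operator.

Definition is_attractor (A : set S) : Prop :=
  has_attractor /\ exists2 K : pcp S, fractal_operator K = K & pcp_set K = A.

End Attractor.

Arguments has_attractor {R} S.
Arguments is_attractor {R} S A.

Record homeomorphism_onto (T U : topologicalType) (f : T -> U) (B : set U) : Prop := {
  homeo_continuous : continuous f;
  homeo_bij : set_bij setT B f;
  homeo_inverse : exists2 g : U -> T, cancel f g & {within B, continuous g} }.

(* Meant for non-empty bounded [A]: [sup] is 0 on unbounded sets. *)
Definition diam (R : realType) (X : metricType R) (A : set X) : R :=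
  sup [set mdist p.1 p.2 | p in A `*` A].

Section Interpolation.
Context (R : realType) (Y : metricType R).

Definition data_system (x : nat -> R) (y : nat -> Y) : Prop :=
  [/\ {homo x : i j / (i < j)%N >-> i < j},
      exists C : R, forall n, `|x n| <= C
    & exists M : Y, y @ \oo --> M].

Definition interpolation_function (x : nat -> R) (y : nat -> Y) (a b : R)
    (f : seg a b -> Y) : Prop :=
  continuous f /\ forall n (s : seg a b), set_val s = x n -> f s = y n.

Lemma theta_gt0 (c L : R) : c < 1 -> 0 < L -> 0 < (1 - c) / (2 * (L + 1)).
Proof. by move=> c1 L0; rewrite divr_gt0 ?subr_gt0// mulr_gt0// addr_gt0. Qed.

Definition theta_num (c L : R) (hc : c < 1) (hL : 0 < L) : {posnum R} :=
  PosNum (theta_gt0 hc hL).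

Context (theta : {posnum R}) (a b : R).
Context (l : nat -> seg a b -> seg a b) (W : nat -> seg a b * Y -> Y).

(* [l n] and [W n] stand for l_(n+1) and W_(n+1). The codomain of [l n] is the
   whole of [a, b]; that it is a homeomorphism onto a subinterval is stated with
   [homeomorphism_onto]. *)
Definition interp_map (n : nat) (p : wprod theta (seg a b) Y) :
    wprod theta (seg a b) Y := (l n p.1, W n p).

Lemma interp_map_continuous : (forall n, continuous (l n)) ->
  (forall n, continuous (W n)) -> forall n, continuous (interp_map n).
Proof.
move=> hl hW n.
have h : continuous (fun p : seg a b * Y => (l n p.1, W n p)).
  move=> p A [[B C] /= [hB hC] BCA]; rewrite nbhs_simpl/=.
  have h1 : \forall q \near p, B (l n q.1).
    have h := @continuous_comp _ _ _ (fst : seg a b * Y -> seg a b) (l n) p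
      (@cvg_fst _ _ _ _ _) (hl n p.1).
    exact: h B hB.
  by apply: filterS2 h1 (hW n p C hC) => q Bq Cq; exact: BCA.
move=> p A hA; have h1 := @of_wprod_continuous R theta (seg a b) Y p.
have h2 := @to_wprod_continuous R theta (seg a b) Y (l n p.1, W n p) A hA.
exact: h1 _ (h p _ h2).
Qed.

Definition interp_cifs (hY : compact [set: Y]) (hl : forall n, continuous (l n))
    (hW : forall n, continuous (W n)) : cifs R :=
  Cifs (wprod_compact (theta := theta) (@seg_compact _ a b) hY)
       (interp_map_continuous hl hW).

End Interpolation.

Arguments interp_cifs {R Y} theta {a b} l W hY hl hW.

(* Main.v *)
(* The graph of f is fixed by the fractal operator when f (l_n s) = W_n (s, f s)
   for all n and s, so f_* is sought as a fixed point of the operator sending f to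
   the function that is W_n (t, f t) at l_n t and M at b. The hypotheses on phi
   give, for every e > 0, some q < 1 with phi t <= max (e, q t); hence the
   iterates of that operator converge uniformly, whatever the initial function.
   Continuity of the limit is proved afterwards, by showing that a bound w on its
   oscillation at all points can be improved to max (e, q w); at b one uses instead
   that the images of the W_n shrink. In the metric d_theta the maps f_n satisfy a
   contraction estimate of the same max (e, q t) form; it passes to the Hausdorff
   distance and makes the graph the globally attracting fixed point. *)
Require Import Defs.
From HB Require Import structures.
From mathcomp Require Import all_boot all_order all_algebra.
From mathcomp Require Import all_classical all_reals all_analysis.
From mathcomp Require Import lra.
Import Order.TTheory GRing.Theory Num.Theory.
Import numFieldNormedType.Exports.
Import metricType_numDomainType.
Local Open Scope classical_set_scope.
Local Open Scope ring_scope.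

Set Implicit Arguments.
Unset Strict Implicit.
Unset Printing Implicit Defensive.

(** * Comparison functions and bounds of the form max (e, q t) *)

Section Comparison.
Context {R : realType}.
Implicit Types (phi : R -> R) (e q t C : R).

(** A contraction up to the error [e]; the factor [q] depends on [e] and may approach 1 as [e] tends
    to 0. *)
Definition comparison phi : Prop := forall e, 0 < e ->
  exists2 q, 0 <= q < 1 & forall t, 0 <= t -> phi t <= Num.max e (q * t).

(** On [[0, e]] monotonicity gives phi t <= phi e < e; beyond [e] the ratio phi t / t is at most its
    value at [e], which serves as [q]. *)
Lemma ratio_comparison phi :
  (forall s t, 0 <= s -> s <= t -> phi s <= phi t) ->
  (forall t, 0 < t -> phi t / t < 1) ->
  (forall s t, 0 < s -> s <= t -> phi t / t <= phi s / s) ->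
  comparison phi.
Proof.
move=> mono lt1 ratio e e0; exists (Num.max 0 (phi e / e)).
  by rewrite le_max lexx gt_max ltr01 lt1.
move=> t t0; rewrite le_max; have [te|et] := leP t e.
  apply/orP; left; apply: le_trans (mono _ _ t0 te) _.
  by have := lt1 _ e0; rewrite ltr_pdivrMr// mul1r => /ltW.
apply/orP; right; have t_gt0 := lt_trans e0 et.
by rewrite -ler_pdivrMr// le_max ratio ?orbT// ltW.
Qed.

(** For positive [t], the choice [e = t / 2] gives [phi t < t]. *)
Lemma comparison_fix_eq0 phi t : comparison phi -> 0 <= t -> t <= phi t -> t = 0.
Proof.
move=> hphi t0 tphi; apply/eqP; rewrite eq_le t0 andbT leNgt; apply/negP => tgt0.
have [q /andP[q0 q1] /(_ _ t0)] := hphi (t / 2) ltac:(by rewrite divr_gt0).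
move=> /(le_trans tphi); rewrite le_max => /orP[|]; first by lra.
by rewrite leNgt gtr_pMl// q1.
Qed.

(** Under iteration the error [e] is absorbed by the maximum instead of accumulating, because
    [q * e <= e]. *)
Lemma maxM_max e q t : 0 <= e -> 0 <= q <= 1 ->
  Num.max e (q * Num.max e t) <= Num.max e (q * t).
Proof.
move=> e0 /andP[q0 q1]; rewrite maxr_pMr// !ge_max !le_max !lexx/= orbT andbT.
by rewrite ler_piMl.
Qed.

Lemma expr_mul_le e q C : 0 < e -> 0 <= q < 1 ->
  exists N, forall k, (N <= k)%N -> q ^+ k * C <= e.
Proof.
move=> e0 /andP[q0 q1]; have := @cvg_geometric R C q.
rewrite ger0_norm// => /(_ q1)/cvgr_le/(_ _ e0)[N _ hN].
by exists N => k Nk; rewrite mulrC; exact: hN.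
Qed.

End Comparison.

(** * Weak contractions: fixed points and passage to the Hausdorff distance *)

Section WeakContraction.
Context {R : realType}.

(* The families for which [phi] can be chosen as a comparison function with
   [mdist (f i p) (f i p') <= phi (mdist p p')]. *)
Definition weak_contractions (I : Type) (X : metricType R) (f : I -> X -> X) : Prop :=
  forall e : R, 0 < e -> exists2 q : R, 0 <= q < 1 &
    forall i p p', mdist (f i p) (f i p') <= Num.max e (q * mdist p p').

(** The fixed point being given, only uniqueness and convergence remain; the latter follows from a
    bound max (e / 2, q^k d) on the distance from [z] to the k-th iterate, with d the initial
    distance. *)
Lemma weak_contraction_picard (Z : metricType R) (g : Z -> Z) (z : Z) :
  weak_contractions (fun _ : unit => g) -> g z = z -> picard_operator g.
Proof.
move=> hg gz; exists z; split=> // [w gw|w].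
  apply: mdist_positivity; apply/eqP; rewrite eq_le mdist_ge0 andbT leNgt.
  apply/negP => d0; have d2 : 0 < mdist w z / 2 by rewrite divr_gt0.
  have [q /andP[q0 q1] /(_ tt w z)] := hg _ d2.
  rewrite gw gz le_max => /orP[|]; first by lra.
  by rewrite leNgt gtr_pMl// q1.
apply/metricType_numDomainType.cvgrPdist_lt => e e0.
have e2 : 0 < e / 2 by rewrite divr_gt0.
have [q q01 hq] := hg _ e2.
have /andP[q0 /ltW q1] := q01.
have [N hN] := @expr_mul_le _ _ _ (mdist z w) e2 q01.
have hk k : mdist z (iter k g w) <= Num.max (e / 2) (q ^+ k * mdist z w).
  elim: k => [|k IH]; first by rewrite expr0 mul1r le_max lexx orbT.
  rewrite iterS -{1}gz; apply: le_trans (hq tt _ _) _.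
  rewrite exprS -mulrA; apply: le_trans (maxM_max _ (ltW e2) _); last by rewrite q0.
  by rewrite ge_max !le_max lexx/= ler_wpM2l// orbT.
exists N => // k /= Nk; apply: le_lt_trans (hk k) _.
by rewrite gt_max; have := hN _ Nk; lra.
Qed.

Lemma excess_le_hausdorff (X : metricType R) (A B : pcp X) :
  excess A B <= mdist A B /\ excess B A <= mdist A B.
Proof. by rewrite /mdist/= /pcp_dist /hausdorff_dist !le_max !lexx orbT. Qed.

Lemma closure_approx (X : metricType R) (A : set X) (p : X) (e : R) :
  0 < e -> closure A p -> exists2 r, A r & mdist p r < e.
Proof.
move=> e0 /(_ [set r | mdist p r < e])[|r [Ar pr]]; last by exists r.
by apply/nbhs_mdistP; exists e.
Qed.

(** The factor [q] is common to all the maps, so it survives the infinite union: a point near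
    [f_n u] with [u] in [A] is compared with [f_n v], where [v] in [B] is almost closest to [u]. *)
Lemma fractal_operator_weak_contraction (S : cifs R) :
  weak_contractions (@cifs_map _ S) ->
  weak_contractions (fun _ : unit => @fractal_operator R S).
Proof.
move=> hS e e0; have [q /[dup] q01 /andP[q0 q1] hq] := hS e e0.
exists q => // -[].
(* The bound is non-decreasing in the distance, so each of the two excesses may be treated
   separately. *)
suff H (A B : pcp S) : excess (fractal_operator A) (fractal_operator B)
    <= Num.max e (q * excess A B).
  move=> A B; have [AB BA] := excess_le_hausdorff A B.
  rewrite {1}/mdist/= /pcp_dist /hausdorff_dist ge_max; apply/andP; split.
    apply: le_trans (H A B) _; rewrite ge_max !le_max lexx/=.
    by rewrite (ler_wpM2l q0 AB) orbT.
  apply: le_trans (H B A) _; rewrite ge_max !le_max lexx/=.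
  by rewrite (ler_wpM2l q0 BA) orbT.
apply: excess_le => p FAp; apply/ler_addgt0Pl => d d0.
(* One half of [d] pays for the closure, the other for the infimum in [dist_to]. *)
have d2 : 0 < d / 2 by rewrite divr_gt0.
have [_ [n _ [u Au <-]] pu] := closure_approx d2 FAp.
have [v Bv uv] := dist_to_lt u B d2.
have FBv : pcp_set (fractal_operator B) (cifs_map n v).
  by apply: subset_closure; exists n => //; exists v.
apply: le_trans (dist_to_le _ FBv) _.
apply: le_trans (metric_triangle _ (cifs_map n u) _) _.
have uvle : mdist u v <= excess A B + d / 2.
  by apply: le_trans (ltW uv) _; rewrite lerD2r; exact: dist_to_le_excess.
rewrite [d]splitr -addrA; apply: lerD (ltW pu) _.
apply: le_trans (hq n u v) _; rewrite ge_max; apply/andP; split.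
  by apply: ler_wpDl (ltW d2) _; rewrite le_max lexx.
apply: le_trans (ler_wpM2l q0 uvle) _.
rewrite mulrDr addrC; apply: lerD; first by rewrite le_max lexx orbT.
by rewrite ler_piMl// ltW.
Qed.

Lemma compact_mdist_bounded (Y : metricType R) : compact [set: Y] ->
  exists D : R, forall u v : Y, mdist u v <= D.
Proof.
move=> hY; have [Y0|/set0P/negP] := pselect ([set: Y] !=set0); last first.
  by rewrite negbK => /eqP Y0; exists 0 => u; have : set0 u by rewrite -Y0.
have [w _] := Y0; have [C hC] := pcp_bounded (Pcp Y0 hY) w.
exists (C + C) => u v; apply: le_trans (metric_triangle _ w _) _.
by rewrite (metric_sym u); apply: lerD; exact: hC.
Qed.

(** A contraction principle for the uniform distance, which enters only through its upper bounds
    [r]. Iterates from any two initial functions become uniformly close, so the sequence of iterates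
    is uniformly Cauchy; compactness of [Y] supplies the pointwise limits. *)
Lemma uniform_fixed_point (S : Type) (Y : metricType R)
    (T : (S -> Y) -> S -> Y) (f0 : S -> Y) :
  compact [set: Y] ->
  (forall e : R, 0 < e -> exists2 q : R, 0 <= q < 1 &
    forall f g r, (forall s, mdist (f s) (g s) <= r) ->
      forall s, mdist (T f s) (T g s) <= Num.max e (q * r)) ->
  exists f, forall s, T f s = f s.
Proof.
move=> hY hT; have [D hD] := compact_mdist_bounded hY.
have close e : 0 < e -> exists N, forall k f g s, (N <= k)%N ->
    mdist (iter k T f s) (iter k T g s) <= e.
  move=> e0; have [q /[dup] q01 /andP[q0 q1] hq] := hT e e0.
  have [N hN] := @expr_mul_le _ _ _ D e0 q01.
  have hk k f g s : mdist (iter k T f s) (iter k T g s) <= Num.max e (q ^+ k * D).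
    elim: k s => [|k IH] s; first by rewrite expr0 mul1r le_max hD orbT.
    rewrite !iterS exprS -mulrA.
    apply: le_trans (maxM_max _ (ltW e0) _); last by rewrite q0 ltW.
    exact: hq.
  exists N => k f g s Nk; apply: le_trans (hk _ _ _ _) _.
  by rewrite ge_max lexx hN.
have cauchy e : 0 < e -> exists N, forall j k s, (N <= j)%N -> (N <= k)%N ->
    mdist (iter j T f0 s) (iter k T f0 s) <= e.
  move=> /close[N hN]; exists N => j k s.
  wlog jk : j k / (j <= k)%N => [H Nj Nk|Nj _].
    by have [/H|/ltnW/H] := leqP j k; [apply|rewrite metric_sym; apply].
  (* The k-th iterate of [f0] is the j-th iterate of another initial function,
     [iter (k - j) T f0]. *)
  by rewrite -(subnKC jk) iterD; exact: hN.
have [f hf] : exists f : S -> Y, forall s,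
    cluster ((fun k => iter k T f0 s) @ \oo) (f s).
  suff /boolp.choice : forall s, exists z, cluster ((fun k => iter k T f0 s) @ \oo) z.
    by case=> f hf; exists f.
  move=> s; have [] := hY ((fun k => iter k T f0 s) @ \oo) _; first exact: filterT.
  move=> z [_ hz]; by exists z.
(* A cluster point of a Cauchy sequence is its limit, and [N] stays independent of [s]. *)
have lim e : 0 < e -> exists N, forall k s, (N <= k)%N -> mdist (iter k T f0 s) (f s) <= e.
  move=> e0; have e2 : 0 < e / 2 by rewrite divr_gt0.
  have [N hN] := cauchy _ e2; exists N => k s Nk.
  have [_ [/= [j Nj <-] hj]] : exists z,
      [set iter j T f0 s | j in [set j | (N <= j)%N]] z /\ mdist (f s) z < e / 2.
    apply: (hf s); first by exists N => // j /= Nj; exists j.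
    by apply/nbhs_mdistP; exists (e / 2).
  have := hN k j s Nk Nj; have := metric_triangle (iter k T f0 s) (iter j T f0 s) (f s).
  by rewrite (metric_sym (iter j T f0 s) (f s)); lra.
exists f => s; apply: mdist_positivity; apply/eqP.
rewrite eq_le mdist_ge0 andbT; apply/ler_addgt0Pl => e e0; rewrite addr0.
have e2 : 0 < e / 2 by rewrite divr_gt0.
have [q /andP[q0 q1] hq] := hT _ e2.
have [N hN] := lim _ e2.
(* Both [T f] and [f] are within [e / 2] of the iterate of order [N.+1]. *)
have h1 : mdist (T (iter N T f0) s) (T f s) <= e / 2.
  apply: le_trans (hq _ _ (e / 2) (fun t => hN N t (leqnn N)) s) _.
  by rewrite ge_max lexx ler_piMl// ltW.
have h2 := hN N.+1 s (leqnSn N); rewrite iterS in h2.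
have := metric_triangle (T f s) (T (iter N T f0) s) (f s).
by rewrite (metric_sym (T f s) (T (iter N T f0) s)); lra.
Qed.

End WeakContraction.

(** * Half-open intervals between consecutive terms of an increasing sequence *)

Section Bracketing.
Context {R : realType} (x : nat -> R) (b : R).
Hypothesis x_incr : {homo x : i j / (i < j)%N >-> i < j}.
Hypothesis x_lim : x n @[n --> \oo] --> b.

Lemma incr_lt_lim n : x n < b.
Proof.
apply: lt_le_trans (x_incr (ltnSn n)) _; rewrite -(cvg_lim (@Rhausdorff R) x_lim).
apply: limr_ge; first by apply/cvg_ex; exists b.
by exists n.+1 => // k /=; rewrite leq_eqVlt => /orP[/eqP->//|/x_incr/ltW].
Qed.

Lemma lt_lim_bracket s : x 0%N <= s -> s < b -> exists n, x n <= s < x n.+1.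
Proof.
move=> x0s sb.
have : exists n, s < x n.
  have [N _ /(_ _ (leqnn N)) hN] := cvgr_gt _ x_lim _ sb.
  by exists N.
move=> /ex_minnP[[|n] sn min]; first by rewrite ltNge x0s in sn.
by exists n; rewrite sn andbT leNgt; apply/negP => /min; rewrite ltnn.
Qed.

Lemma bracket_inj i j s : x i <= s < x i.+1 -> x j <= s < x j.+1 -> i = j.
Proof.
wlog ij : i j / (i <= j)%N => [H hi hj|/andP[_ si] /andP[js _]].
  by have [/H|/ltnW/H] := leqP i j; [apply|move=> h; rewrite h].
apply/eqP; rewrite eqn_leq ij leqNgt; apply/negP; rewrite leq_eqVlt => ij1.
have : x i.+1 <= x j by case/predU1P: ij1 => [->//|/x_incr/ltW].
by move=> /le_trans/(_ js); rewrite leNgt si.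
Qed.

End Bracketing.

(** The smallness of [theta] lets the Lipschitz term of [W] be absorbed by the first coordinate,
    whose factor grows only from [c] to [c' = (1 + c) / 2]; the second coordinate is governed by
    [phi]. *)
Lemma interp_map_weak_contraction (R : realType) (Y : metricType R)
    (theta : {posnum R}) (a b : R) (l : nat -> seg a b -> seg a b)
    (W : nat -> seg a b * Y -> Y) (c L : R) (phi : R -> R) :
  0 <= c < 1 -> theta%:num * L <= (1 - c) / 2 -> comparison phi ->
  (forall n (s t : seg a b),
     `|set_val (l n s) - set_val (l n t)| <= c * `|set_val s - set_val t|) ->
  (forall n (s s' : seg a b) (u u' : Y), mdist (W n (s, u)) (W n (s', u')) <=
     L * `|set_val s - set_val s'| + phi (mdist u u')) ->
  weak_contractions (@interp_map R Y theta a b l W).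
Proof.
move=> /andP[c0 c1] thetaL hphi hl hW e e0.
have th0 : 0 < theta%:num by [].
set th := theta%:num in thetaL th0 *.
set c' := (1 + c) / 2; have [c'0 c'1] : 0 <= c' /\ c' < 1 by rewrite /c'; lra.
(* After multiplication by [theta], the error [d] takes up half of the room that [c' * e] leaves
   below [e]. *)
set d := (1 - c') * e / 2 / th.
have d0 : 0 < d by rewrite !divr_gt0// mulr_gt0// subr_gt0.
have [q /andP[q0 q1] hq] := hphi d d0.
exists (Num.max q ((1 + c') / 2)).
  by rewrite le_max q0/= gt_max q1; lra.
move=> n [s u] [s' u']; rewrite !wprod_mdistE /= -/th.
have -> : mdist s s' = `|set_val s - set_val s'| by [].
have -> : mdist (l n s) (l n s') = `|set_val (l n s) - set_val (l n s')| by [].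
move: (hl n s s') (hW n s s' u u') (hq _ (mdist_ge0 u u')) (mdist_ge0 u u').
move: (mdist (W n _) _) (mdist u u') => w v.
move: `|set_val s - _| (normr_ge0 (set_val s - set_val s')) => r r0.
move: `|set_val (l n s) - _| => lr hlr hw hpv v0.
have {}hw : th * w <= (1 - c) / 2 * r + th * Num.max d (q * v).
  apply: le_trans (_ : th * (L * r + Num.max d (q * v)) <= _).
    by rewrite ler_pM2l//; apply: le_trans hw _; rewrite lerD2l.
  by rewrite mulrDr mulrA lerD2r ler_wpM2r.
have {hlr hw}h : lr + th * w <= c' * r + th * Num.max d (q * v).
  by move: (th * w) (th * _) hw => A B; rewrite /c'; lra.
apply: le_trans h _; rewrite maxr_pMr ?(ltW th0)//.
have thd : th * d = (1 - c') * e / 2 by rewrite mulrC divfK// gt_eqF.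
have thv : 0 <= th * v by rewrite mulr_ge0// ltW.
rewrite addr_maxr ge_max; apply/andP; split.
  (* If the distance is at most [e], the sum stays below [e]; otherwise [e] in the error is replaced
     by the distance, which gives the factor [(1 + c') / 2]. *)
  rewrite thd le_max; have [te|et] := leP (r + th * v) e.
    have re : r <= e by lra.
    have := ler_wpM2l c'0 re; have : 0 <= (1 - c') * e by rewrite mulr_ge0; lra.
    by move=> ? ?; apply/orP; left; lra.
  apply/orP; right.
  apply: le_trans (_ : (1 + c') / 2 * (r + th * v) <= _); last first.
    by rewrite ler_wpM2r ?addr_ge0// le_max lexx orbT.
  have rt : r <= r + th * v by rewrite lerDl.
  have := ler_wpM2l c'0 rt; move: (r + th * v) et => t et.
  have : (1 - c') * e <= (1 - c') * t by apply: ler_wpM2l; lra.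
  lra.
rewrite le_max mulrDr; apply/orP; right; apply: lerD.
  by rewrite ler_wpM2r// le_max; apply/orP; right; lra.
by rewrite mulrCA ler_wpM2r// le_max lexx.
Qed.

Lemma seg_itv (R : realType) (a b : R) (s : seg a b) : a <= set_val s <= b.
Proof. by have := set_mem (valP s); rewrite /= in_itv. Qed.

Lemma seg_point (R : realType) (a b r : R) : a <= r <= b ->
  exists s : seg a b, set_val s = r.
Proof.
move=> rab; have h : r \in `[a, b]%classic by rewrite inE/= in_itv.
by exists (exist _ r h).
Qed.

(** * Construction of the interpolant on the pieces *)

Section Interpolant.
Context {R : realType} {Y : metricType R}.
Hypothesis Y_compact : compact [set: Y].
Context (x : nat -> R) (y : nat -> Y) (b : R) (M : Y).
Hypothesis x_incr : {homo x : i j / (i < j)%N >-> i < j}.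
Hypothesis x_lim : x n @[n --> \oo] --> b.
Hypothesis y_lim : y n @[n --> \oo] --> M.
Local Notation I := (seg (x 0%N) b).
Context (l : nat -> I -> I).
Hypothesis l_homeo : forall n, homeomorphism_onto (l n)
  [set s : I | x n <= set_val s <= x n.+1].
Hypothesis l_left : forall n (s : I), set_val s = x 0%N -> set_val (l n s) = x n.
Hypothesis l_right : forall n (s : I), set_val s = b -> set_val (l n s) = x n.+1.
Context (W : nat -> I * Y -> Y).
Hypothesis W_left : forall n (s : I), set_val s = x 0%N -> W n (s, y 0%N) = y n.
Hypothesis W_right : forall n (s : I), set_val s = b -> W n (s, M) = y n.+1.
Context (L : R) (phi : R -> R).
Hypothesis L_gt0 : 0 < L.
Hypothesis phi_comparison : comparison phi.
Hypothesis W_phi : forall n (s s' : I) (u u' : Y),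
  mdist (W n (s, u)) (W n (s', u')) <=
  L * `|set_val s - set_val s'| + phi (mdist u u').

Let x0_lt_b : x 0%N < b. Proof. exact: incr_lt_lim. Qed.

Lemma seg_val_inj (s t : I) : set_val s = set_val t -> s = t.
Proof. exact: val_inj. Qed.

Lemma piece_itv n s : x n <= set_val (l n s) <= x n.+1.
Proof. by have [h _ _] := homeo_bij (l_homeo n); exact: (h s). Qed.

Lemma piece_inj n : injective (l n).
Proof. by have [g gK _] := homeo_inverse (l_homeo n); exact: can_inj gK. Qed.

Lemma piece_surj n (s : I) : x n <= set_val s <= x n.+1 -> exists t, l n t = s.
Proof.
by have [_ _ h] := homeo_bij (l_homeo n); move=> /h[t _ <-]; exists t.
Qed.

(** By injectivity only [b] reaches the right end point. Leaving [b] out of the domain thus makes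
    the images of the [l n] disjoint, whereas closed pieces share their nodes. *)
Lemma piece_lt n s : set_val s < b -> x n <= set_val (l n s) < x n.+1.
Proof.
move=> sb; have /andP[-> /=] := piece_itv n s; rewrite le_eqVlt => /predU1P[ls|//].
have [t tb] := @seg_point _ (x 0%N) b b ltac:(by rewrite lexx ltW).
have st : s = t by apply: (@piece_inj n); apply: seg_val_inj; rewrite ls l_right.
by move: sb; rewrite st tb ltxx.
Qed.

Lemma piece_cover (s : I) : set_val s < b ->
  exists n t, l n t = s /\ set_val t < b.
Proof.
move=> sb; have /andP[x0s _] := seg_itv s.
have [n /andP[ns sn]] := lt_lim_bracket x_lim x0s sb.
have [|t lt] := @piece_surj n s; first by rewrite ns ltW.
exists n, t; split=> //; have /andP[_ ] := seg_itv t.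
rewrite le_eqVlt => /predU1P[tb|//].
by move: sn; rewrite -lt l_right// ltxx.
Qed.

Lemma piece_unique i j (s t : I) : set_val s < b -> set_val t < b ->
  l i s = l j t -> i = j /\ s = t.
Proof.
move=> sb tb ll; have ij : i = j.
  apply: (@bracket_inj _ x x_incr _ _ (set_val (l i s))); first exact: piece_lt.
  by rewrite ll; exact: piece_lt.
by split=> //; apply: (@piece_inj i); rewrite ll ij.
Qed.

Lemma exists_interpolant : exists f : I -> Y,
  [/\ forall s, set_val s = x 0%N -> f s = y 0%N,
      forall s, set_val s = b -> f s = M
    & forall n s, f (l n s) = W n (s, f s)].
Proof.
(* [code s] is the address of [s]: its piece and its preimage there, or [None] at [b]. *)
have [code codeP] : exists code : I -> option (nat * I), forall s,
    match code s with
    | None => set_val s = b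
    | Some (n, t) => l n t = s /\ set_val t < b
    end.
  suff /boolp.choice[code codeP] : forall s, exists c : option (nat * I),
    match c with
    | None => set_val s = b
    | Some (n, t) => l n t = s /\ set_val t < b
    end by exists code.
  move=> s; have /andP[_ ] := seg_itv s.
  rewrite le_eqVlt => /predU1P[sb|/piece_cover[n [t nt]]]; first by exists None.
  by exists (Some (n, t)).
pose T (f : I -> Y) (s : I) : Y :=
  if code s is Some (n, t) then W n (t, f t) else M.
have [|f Tf] := @uniform_fixed_point _ I Y T (fun=> M) Y_compact.
  move=> e e0; have [q /[dup] q01 /andP[q0 q1] hq] := phi_comparison e0.
  exists q => // f g r fg s; rewrite /T; case: (code s) => [[n t]|]; last first.
    by rewrite mdistxx le_max ltW.
  apply: le_trans (W_phi n t t (f t) (g t)) _.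
  rewrite subrr normr0 mulr0 add0r; apply: le_trans (hq _ (mdist_ge0 _ _)) _.
  by rewrite ge_max !le_max lexx/= ler_wpM2l// orbT.
have f_right s : set_val s = b -> f s = M.
  move=> sb; rewrite -Tf /T; case: (code s) (codeP s) => [[n t] [nt tb]|//].
  have /andP[_] := piece_lt n tb; rewrite nt sb => bx.
  by have := lt_trans bx (incr_lt_lim x_incr x_lim n.+1); rewrite ltxx.
have f_piece n s : set_val s < b -> f (l n s) = W n (s, f s).
  move=> sb; rewrite -[LHS]Tf /T; case: (code _) (codeP (l n s)) => [[i t] [it tb]|lb].
    by have [-> ->] := piece_unique tb sb it.
  have /andP[_] := piece_lt n sb; rewrite lb => bx.
  by have := lt_trans bx (incr_lt_lim x_incr x_lim n.+1); rewrite ltxx.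
(* The left end point is fixed by [l 0], so [f s] and [y 0] are both fixed by [W 0 (s, _)]. *)
have f_left s : set_val s = x 0%N -> f s = y 0%N.
  move=> sa; apply: mdist_positivity.
  apply: (comparison_fix_eq0 phi_comparison (mdist_ge0 _ _)).
  have ls : l 0%N s = s by apply: seg_val_inj; rewrite l_left.
  rewrite -{1}ls f_piece ?sa// -(W_left 0%N sa).
  by apply: le_trans (W_phi _ _ _ _ _) _; rewrite W_left// subrr normr0 mulr0 add0r.
exists f; split=> // n s; have /andP[_] := seg_itv s.
rewrite le_eqVlt => /predU1P[sb|/f_piece//].
have [t ta] := @seg_point _ (x 0%N) b (x 0%N) ltac:(by rewrite lexx ltW).
(* At [b] the equation concerns a shared node, whose address lies in the next piece; the end point
   conditions on [W] make the two values agree. *)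
have -> : l n s = l n.+1 t by apply: seg_val_inj; rewrite l_right// l_left.
by rewrite f_piece ?ta// f_left// W_left// f_right// W_right.
Qed.

(** * Continuity of the interpolant *)

Section Regularity.
Context (f : I -> Y).
Hypothesis f_left : forall s, set_val s = x 0%N -> f s = y 0%N.
Hypothesis f_right : forall s, set_val s = b -> f s = M.
Hypothesis f_piece : forall n s, f (l n s) = W n (s, f s).
Hypothesis W_diam : diam (range (W n)) @[n --> \oo] --> (0 : R).

Lemma interpolant_node n (s : I) : set_val s = x n -> f s = y n.
Proof.
move=> sn; have [t ta] := @seg_point _ (x 0%N) b (x 0%N) ltac:(by rewrite lexx ltW).
have -> : s = l n t by apply: seg_val_inj; rewrite sn l_left.
by rewrite f_piece f_left// W_left.
Qed.

(** Compactness makes the [sup] in [diam] a true supremum rather than the default 0. *)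
Lemma mdist_le_diam (A : set Y) u v : A u -> A v -> mdist u v <= diam A.
Proof.
move=> Au Av; have [D hD] := compact_mdist_bounded Y_compact.
apply: ub_le_sup; last by exists (u, v).
by exists D => _ [p _ <-]; exact: hD.
Qed.

(** A point beyond [x N] lies in a piece of index [n >= N]; there [f] takes values in the range of
    [W n], a small set that contains [y n], itself close to [M]. *)
Lemma interpolant_near_right e : 0 < e -> exists2 d, 0 < d &
  forall s t : I, set_val s = b -> `|set_val s - set_val t| < d -> mdist (f s) (f t) <= e.
Proof.
move=> e0; have e2 : 0 < e / 2 by rewrite divr_gt0.
have [N _ hN] : \forall n \near \oo, diam (range (W n)) < e / 2 /\ mdist M (y n) < e / 2.
  near=> n; split; near: n; first exact: cvgr_lt W_diam _ e2.
  exact: metricType_numDomainType.cvgr_dist_lt y_lim _ e2.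
exists (b - x N); first by rewrite subr_gt0 incr_lt_lim.
move=> s t sb; rewrite f_right// sb; have /andP[x0t] := seg_itv t.
rewrite le_eqVlt => /predU1P[tb _|tb]; first by rewrite f_right// mdistxx ltW.
rewrite ger0_norm ?subr_ge0 ?(ltW tb)// ltrD2l ltrN2 => xNt.
have [n [r [nr rb]]] := piece_cover tb.
have Nn : (N <= n)%N.
  rewrite leqNgt; apply/negP => nN; have /andP[_] := piece_itv n r.
  rewrite nr leNgt => /negP; apply; apply: le_lt_trans xNt.
  by move: nN; rewrite leq_eqVlt => /predU1P[->//|/x_incr/ltW].
have [hd hy] := hN n Nn.
have [p pa] := @seg_point _ (x 0%N) b (x 0%N) ltac:(by rewrite lexx ltW).
have : mdist (y n) (f t) <= diam (range (W n)).
  rewrite -nr f_piece -(W_left n pa).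
  by apply: mdist_le_diam; [exists (p, y 0%N)|exists (r, f r)].
by have := metric_triangle M (y n) (f t); lra.
Unshelve. all: by end_near. Qed.

(* Since [f (l n r) = W n (r, f r)], oscillation [w] at [r] becomes at most [phi w]
   at [l n r], up to [e'] from the Lipschitz term. *)
Lemma interpolant_osc_piece n w e (s : I) :
  (forall s, exists2 d, 0 < d & forall t : I, `|set_val s - set_val t| < d ->
     mdist (f s) (f t) <= w) ->
  (forall t, 0 <= t -> t <= w -> phi t <= e) -> forall e', 0 < e' ->
  exists2 d, 0 < d & forall t : I, x n <= set_val t <= x n.+1 ->
    `|set_val s - set_val t| < d -> mdist (f s) (f t) <= e + e'.
Proof.
move=> hw hphi e' e'0.
(* For [s] outside the closed piece, [d] is its distance to the piece and the claim is vacuous. *)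
have [sn|ns] := ltP (set_val s) (x n).
  exists (x n - set_val s); first by rewrite subr_gt0.
  move=> t /andP[nt _]; rewrite distrC ger0_norm ?subr_ge0 ?(le_trans (ltW sn))//.
  by rewrite ltrD2r ltNge nt.
have [sn|sn] := ltP (x n.+1) (set_val s).
  exists (set_val s - x n.+1); first by rewrite subr_gt0.
  move=> t /andP[_ nt]; rewrite ger0_norm ?subr_ge0 ?(le_trans nt (ltW sn))//.
  by rewrite ltrD2l ltrN2 ltNge nt.
have [g gK g_cont] := homeo_inverse (l_homeo n).
have gKl (t : I) : x n <= set_val t <= x n.+1 -> l n (g t) = t.
  by move=> /piece_surj[r <-]; rewrite gK.
have s_n : x n <= set_val s <= x n.+1 by rewrite ns sn.
have [d d0 hd] := hw (g s).
(* The bound [e' / L] keeps the Lipschitz term below [e']. *)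
pose d' := Num.min d (e' / L).
have d'0 : 0 < d' by rewrite lt_min d0 divr_gt0.
have /subspace_continuousP/(_ s s_n) := g_cont.
move=> /metricType_numDomainType.cvgr_dist_lt/(_ d' d'0).
rewrite near_withinE => /nbhs_mdistP[k /= k0 hk]; exists k => // t t_n st.
have := hk t st t_n; rewrite lt_min => /andP[gd ge].
rewrite -(gKl s s_n) -(gKl t t_n) !f_piece.
apply: le_trans (W_phi _ _ _ _ _) _; rewrite addrC; apply: lerD.
  by apply: hphi; rewrite ?mdist_ge0// hd.
by rewrite mulrC -ler_pdivlMr// ltW.
Qed.

Lemma interpolant_osc w e e' :
  (forall s, exists2 d, 0 < d & forall t : I, `|set_val s - set_val t| < d ->
     mdist (f s) (f t) <= w) ->
  0 <= e -> (forall t, 0 <= t -> t <= w -> phi t <= e) -> 0 < e' ->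
  forall s, exists2 d, 0 < d & forall t : I, `|set_val s - set_val t| < d ->
    mdist (f s) (f t) <= e + e'.
Proof.
move=> hw e0 hphi e'0 s; have /andP[x0s] := seg_itv s.
rewrite le_eqVlt => /predU1P[sb|sb].
  have [d d0 hd] := interpolant_near_right e'0; exists d => // t st.
  by apply: le_trans (hd _ _ sb st) _; rewrite lerDr.
(* Below [x N] there are finitely many pieces, so the minimum of their radii is positive. *)
have left N : exists2 d, 0 < d & forall t : I, set_val t < x N ->
    `|set_val s - set_val t| < d -> mdist (f s) (f t) <= e + e'.
  elim: N => [|N [d d0 hd]].
    by exists 1 => // t; have /andP[x0t _] := seg_itv t; rewrite ltNge x0t.
  have [k k0 hk] := interpolant_osc_piece N s hw hphi e'0.
  exists (Num.min d k); first by rewrite lt_min d0.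
  move=> t tN; rewrite lt_min => /andP[td tk].
  have [/hd|Nt] := ltP (set_val t) (x N); first exact.
  by apply: hk tk; rewrite Nt ltW.
have [n /andP[_ sn]] := lt_lim_bracket x_lim x0s sb.
have [d d0 hd] := left n.+1.
exists (Num.min d (x n.+1 - set_val s)); first by rewrite lt_min d0 subr_gt0.
move=> t; rewrite lt_min => /andP[td tx]; apply: hd => //.
move: tx; rewrite distrC => /(le_lt_trans (ler_norm _)).
by rewrite ltrD2r.
Qed.

Lemma interpolant_continuous : continuous f.
Proof.
have [D hD] := compact_mdist_bounded Y_compact.
have osc e : 0 < e -> forall s, exists2 d, 0 < d &
    forall t : I, `|set_val s - set_val t| < d -> mdist (f s) (f t) <= e.
  move=> e0; have e2 : 0 < e / 2 by rewrite divr_gt0.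
  have [q /andP[q0 q1] hq] := phi_comparison e2.
  (* With this slack, a bound [w >= e] improves to max (e, r w) for the [r] below, since q w + (1 -
     q) e / 2 <= r w. *)
  have qe : 0 < (1 - q) * e / 2 by rewrite divr_gt0// mulr_gt0// subr_gt0.
  pose r := (1 + q) / 2; have r01 : 0 <= r < 1 by apply/andP; rewrite /r; lra.
  have [N hN] := expr_mul_le D e0 r01.
  have step k s : exists2 d, 0 < d & forall t : I,
      `|set_val s - set_val t| < d -> mdist (f s) (f t) <= Num.max e (r ^+ k * D).
    elim: k s => [|k IH] s.
      (* The improvement starts from the bound [D] on all distances in [Y]. *)
      by exists 1 => // t _; rewrite expr0 mul1r le_max hD orbT.
    have [|t t0 tw|d d0 hd] := @interpolant_osc _
      (Num.max (e / 2) (q * Num.max e (r ^+ k * D))) _ IH _ _ qe s.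
    - by rewrite le_max ltW.
    - apply: le_trans (hq t t0) _.
      by rewrite ge_max !le_max lexx/= ler_wpM2l// orbT.
    exists d => // t /hd{hd}; move/le_trans; apply.
    rewrite exprS -(mulrA r).
    have r01' : 0 <= r <= 1 by have /andP[-> /ltW] := r01.
    apply: le_trans _ (maxM_max _ (ltW e0) r01').
    have : e <= Num.max e (r ^+ k * D) by rewrite le_max lexx.
    move: (Num.max e (r ^+ k * D)) => w ew.
    have qew : 0 <= (1 - q) * (w - e) by rewrite mulr_ge0// subr_ge0// ltW.
    rewrite -lerBrDr ge_max; apply/andP; split; rewrite lerBrDr le_max.
      by apply/orP; left; have := mulr_ge0 q0 (ltW e0); lra.
    by apply/orP; right; rewrite /r; lra.
  move=> s; have [d d0 hd] := step N s; exists d => // t /hd/le_trans; apply.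
  by rewrite ge_max lexx hN.
move=> s A /nbhs_mdistP[e /= e0 eA]; rewrite nbhs_simpl/=.
have e2 : 0 < e / 2 by rewrite divr_gt0.
have [d d0 hd] := osc _ e2 s.
apply/(@nbhs_mdistP R I); exists d => // t /hd ft; apply: eA => /=; lra.
Qed.

(** * The graph as a compact fixed set *)

Section Graph.
Context (theta : {posnum R}).
Hypothesis W_cont : forall n, continuous (W n).
Local Notation S := (interp_cifs theta l W Y_compact
  (fun n => homeo_continuous (l_homeo n)) W_cont).

Let graph (s : I) : S := (s, f s).

Lemma graph_continuous : continuous graph.
Proof.
move=> s A hA; have := @to_wprod_continuous R theta I Y (s, f s) A hA.
exact: (cvg_pair cvg_id (@interpolant_continuous s)).
Qed.

Lemma graph_nonempty : range graph !=set0.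
Proof.
have [t _] := @seg_point _ (x 0%N) b b ltac:(by rewrite lexx ltW).
by exists (graph t); exists t.
Qed.

Lemma graph_compact : compact (range graph).
Proof.
apply: continuous_compact (@seg_compact _ _ _).
exact/continuous_subspaceT/graph_continuous.
Qed.

(** The images of the graph under the maps are its parts over the pieces. Together they miss only
    the point over [b], which the closure restores. *)
Lemma graph_fixed : fractal_set (range graph) = range graph.
Proof.
have cifsE n s : cifs_map n (graph s) = graph (l n s).
  by rewrite /graph f_piece.
apply/seteqP; split=> [p Fp|_ [s _ <-]].
  have /closure_id -> : closed (range graph).
    exact: compact_closed (@metric_hausdorff _ S) graph_compact.
  move: p Fp; apply: closure_subset => _ [n _ [_ [s _ <-] <-]].
  by rewrite cifsE; exists (l n s).
have [u ua] := @seg_point _ (x 0%N) b (x 0%N) ltac:(by rewrite lexx ltW).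
have /andP[_] := seg_itv s; rewrite le_eqVlt => /predU1P[sb|/piece_cover[n [t [<- _]]]].
  move=> A hA; have := @graph_continuous s A hA.
  rewrite nbhs_simpl/= => /(@nbhs_mdistP R I)[d /= d0 hd].
  have bd : b - d < b by rewrite ltrBlDr ltrDl.
  have [N _ /(_ _ (leqnn N)) /= hN] := cvgr_gt _ x_lim _ bd.
  (* The points over the nodes [x N] lie in the union and tend to the point over [b]. *)
  exists (graph (l N u)); split.
    by exists N => //; exists (graph u); [exists u|exact: cifsE].
  apply: hd; rewrite /mdist/= /sub_mdist sb l_left//.
  by rewrite ger0_norm ?subr_ge0 ?(ltW (incr_lt_lim _ _ _))// ltrBlDl -ltrBlDr.
apply: subset_closure; exists n => //.
by exists (graph t); [exists t|exact: cifsE].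
Qed.
End Graph.
End Regularity.
End Interpolant.

Theorem theorem3p3 (R : realType) (Y : metricType R)
  (hY : compact [set: Y])
  (x : nat -> R) (y : nat -> Y) (hxy : data_system x y)
  (a b : R) (m M : Y)
  (ha : a = x 0%N) (hb : x n @[n --> \oo] --> b)
  (hm : m = y 0%N) (hM : y n @[n --> \oo] --> M)
  (l : nat -> seg a b -> seg a b)
  (hl : forall n, homeomorphism_onto (l n)
     [set s : seg a b | x n <= set_val s <= x n.+1])
  (Lip : nat -> R) (hLip01 : forall n, 0 <= Lip n < 1)
  (hlLip : forall n (s t : seg a b),
     `|set_val (l n s) - set_val (l n t)| <= Lip n * `|set_val s - set_val t|)
  (hla : forall n (s : seg a b), set_val s = a -> set_val (l n s) = x n)
  (hlb : forall n (s : seg a b), set_val s = b -> set_val (l n s) = x n.+1)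
  (hLip : sup (range Lip) < 1)
  (W : nat -> seg a b * Y -> Y) (hW : forall n, continuous (W n))
  (hWa : forall n (s : seg a b), set_val s = a -> W n (s, m) = y n)
  (hWb : forall n (s : seg a b), set_val s = b -> W n (s, M) = y n.+1)
  (hWdiam : diam (range (W n)) @[n --> \oo] --> (0 : R))
  (L : R) (hL : 0 < L)
  (phi : R -> R)
  (hphi_ge0 : forall t : R, 0 <= t -> 0 <= phi t)
  (hphi_mono : forall s t : R, 0 <= s -> s <= t -> phi s <= phi t)
  (hphi_lt1 : forall t : R, 0 < t -> phi t / t < 1)
  (hphi_ratio : forall s t : R, 0 < s -> s <= t -> phi t / t <= phi s / s)
  (hWphi : forall n (s s' : seg a b) (u u' : Y),
     mdist (W n (s, u)) (W n (s', u')) <=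
     L * `|set_val s - set_val s'| + phi (mdist u u')) :
  exists f : seg a b -> Y,
    interpolation_function x y f /\
    is_attractor
      (interp_cifs (theta_num hLip hL) l W hY
         (fun n => homeo_continuous (hl n)) hW)
      (range (fun s : seg a b => (s, f s))).

Proof.
have [x_incr _ _] := hxy; subst a m.
have Lip_bounds n : 0 <= Lip n <= sup (range Lip).
  have /andP[-> _] := hLip01 n; apply: ub_le_sup; last by exists n.
  (* The bound 1 makes [sup (range Lip)] a true supremum, hence a common Lipschitz constant. *)
  by exists 1 => _ [k _ <-]; have /andP[_ /ltW] := hLip01 k.
have phi_comparison := ratio_comparison hphi_mono hphi_lt1 hphi_ratio.
have [f [f_left f_right f_piece]] := exists_interpolant hY x_incr hb hl hla hlb
  hWa hWb phi_comparison hWphi.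
exists f; split.
  split; last by move=> n s; exact: (interpolant_node x_incr hb hla hWa f_left f_piece).
  exact: (interpolant_continuous hY x_incr hb hM hl hlb hWa hL phi_comparison hWphi
    f_right f_piece hWdiam).
set S := interp_cifs _ _ _ _ _ _.
have S_contr : weak_contractions (@cifs_map _ S).
  apply: (@interp_map_weak_contraction _ _ _ _ _ l W (sup (range Lip)) L phi) => //.
  - by have /andP[h0 h1] := Lip_bounds 0%N; rewrite (le_trans h0 h1).
  (* Here theta L = ((1 - c) / 2) (L / (L + 1)) with [c = sup (range Lip)], and the last factor is
     at most 1. *)
  - rewrite /=; have L1 : 0 < L + 1 by rewrite addr_gt0.
    have hc : 0 <= 1 - sup (range Lip) by rewrite subr_ge0 ltW.
    rewrite -mulrA ler_wpM2l// invfM -mulrA ler_piMr// mulrC ler_pdivrMr//.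
    by rewrite mul1r lerDl.
  - move=> n s t; apply: le_trans (hlLip n s t) _; rewrite ler_wpM2r//.
    by have /andP[] := Lip_bounds n.
pose th := theta_num hLip hL.
pose K : pcp S := Pcp (graph_nonempty hY x_incr hb hl f th hW)
  (@graph_compact _ _ hY _ _ _ _ x_incr hb hM _ hl hlb _ hWa _ _ hL
     phi_comparison hWphi _ f_right f_piece hWdiam th hW).
have K_fixed : fractal_operator K = K.
  apply: pcp_inj; exact: (graph_fixed hY x_incr hb hM hl hla hlb hWa hL
    phi_comparison hWphi f_right f_piece hWdiam th hW).
split; last by exists K.
exact: weak_contraction_picard (fractal_operator_weak_contraction S_contr) K_fixed.
Qed.
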